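(* Each of the nine continued fraction algorithms $T$ of types $(2,5,\infty)$, $(3,4,\infty)$, $(3,5,\infty)$, $(3,6,\infty)$, $(4,\infty,\infty)$, $(5,\infty,\infty)$, $(6,\infty,\infty)$, $(4,6,\infty)$, $(4,12,\infty)$ described in the context admits a complete set of decreasing blocks.
   Context: **Matrices.** $\mathrm{PSL}_2^\pm R$ is the group of $2\times2$ matrices over $R$ with determinant $\pm1$, modulo $\pm1$; it acts on $\mathrm P^1\mathbb R$ by $\begin{bmatrix}a&b\\ c&d\end{bmatrix}*x=\frac{ax+b}{cx+d}$. Let $I_0=[0,\infty]\subset\mathrm P^1\mathbb R$. **The nine algorithms.** Let $\lambda_k=2\cos(\pi/k)$ and $\tau=(1+\sqrt5)/2$. Each algorithm is given by a quadratic field $K$ with integer ring $\mathbb O$ and a list $A_1,\dots,A_r\in\mathrm{PSL}_2^\pm\mathbb O$; the intervals $I_a=A_a*I_0$ cover $I_0$, meet at most in common endpoints, and are numbered in increasing order from $0$ to $\infty$. The map $T:I_0\to I_0$ is $x\mapsto A_a^{-1}*x$ on $I_a$ (a common endpoint of $I_a,I_{a+1}$ is mapped using $A_a^{-1}$; in all nine cases $T$ is continuous). (I) $(l,m,\infty)\in\{(2,5,\infty),(3,4,\infty),(3,5,\infty),(3,6,\infty)\}$, with $K=\mathbb Q(\sqrt5),\mathbb Q(\sqrt2),\mathbb Q(\sqrt5),\mathbb Q(\sqrt3)$ respectively. Let $F=\begin{bmatrix}0&1\\ 1&0\end{bmatrix}$, $Q=\begin{bmatrix}\lambda_l&1\\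 -1&0\end{bmatrix}$, $R=\begin{bmatrix}0&1\\ -1&\lambda_m\end{bmatrix}$, $r=(l-1)(m-1)$. For $1\le i<m$, $1\le j<l$ and $a=(i-1)(l-1)+j$, put $A_a=R^iQ^j$ if $a$ is even and $A_a=R^iQ^jF$ if $a$ is odd. (II) $(l,\infty,\infty)$ with $l=4,5,6$, $K=\mathbb Q(\sqrt2),\mathbb Q(\sqrt5),\mathbb Q(\sqrt3)$ and $\beta=2+\sqrt2,\,2+\tau,\,2+\sqrt3$ respectively. Let $J=\begin{bmatrix}-1&0\\ 0&1\end{bmatrix}$, $P=\begin{bmatrix}-1&1\\ 0&1\end{bmatrix}$, $M=\begin{bmatrix}1&0\\ \beta&-1\end{bmatrix}$, $r=2l-1$. For $0\le q\le l-2$ put $A_{1+2q}=(MP)^qMJ$, $A_{2+2q}=(MP)^{q+1}J$; and $A_{2l-1}=(MP)^{l-1}MJ=\begin{bmatrix}1&1\\ 0&1\end{bmatrix}$. (III) $(4,m,\infty)$ with $m=6$, $K=\mathbb Q(\sqrt6)$, or $m=12$, $K=\mathbb Q(\sqrt3)$. Write $P_x=\begin{bmatrix}-1&x\\ 0&1\end{bmatrix}$, $M_x=\begin{bmatrix}1&0\\ x&-1\end{bmatrix}$. For $m=6$: $\alpha=3-\sqrt6$, $\beta=3+\sqrt6$, $\gamma=2-\sqrt6$, $\delta=-2-\sqrt6$. For $m=12$: $\alpha=1$, $\beta=2+\sqrt3$, $\gamma=1-\sqrt3$, $\delta=-1-\sqrt3$. Let $U_1=P_\gamma$, $U_2=P_\gamma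 M_\delta$, $U_3=P_\gamma M_\delta P_\gamma$; and, for $1\le j\le m-1$, $V_j=(M_\beta P_\alpha)^{j/2}$ if $j$ is even, $V_j=(M_\beta P_\alpha)^{(j-1)/2}M_\beta$ if $j$ is odd. Let $r=3(m-1)$, and put $(A_{3j-2},A_{3j-1},A_{3j})=(V_jU_3,V_jU_2,V_jU_1)$ if $j$ is odd, and $=(V_jU_1,V_jU_2,V_jU_3)$ if $j$ is even. **The sets $E^\sharp$.** Let $'$ denote the nontrivial automorphism of $K$ and $\lor$ the maximum. A matrix $A=\begin{bmatrix}a&b\\ c&d\end{bmatrix}\in\mathrm{PSL}_2^\pm\mathbb O$ is positive if, up to multiplication by $-1$, all entries are $\ge0$, with at most one equal to $0$; we then write it with entries $\ge 0$. All products of the $A_a$ used below are positive. For positive $A$ let $f_A(x)=\frac{(ax+b)\lor(cx+d)}{x\lor1}$ for $x\in[0,\infty]$ (with $f_A(\infty)=a\lor c$), $t(A)=(|a'|+|c'|)\lor(|b'|+|d'|)$, and $E^\sharp(A)=\{x\in[0,\infty]:f_A(x)>t(A)\}$. Closures and boundaries $\partial$ are taken in $[0,\infty]$. **Decreasing blocks.** Let $\mathfrak A=\{1,\dots,r\}$, $\mathfrak A^*$ the set of finite words and $\mathfrak A^\omega$ the set of one-sided infinite sequences over $\mathfrak A$. A decreasing block is a word $b_0\cdots b_u\in\mathfrak A^*$ of length $u+1\ge2$ such that: (i) $b_0,b_u\ne r$; (ii) $I_{b_u}$ is contained in the closure of $E^\sharp(A)$, where $A=A_{b_0}\cdots A_{b_{u-1}}=\begin{bmatrix}a&b\\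 c&d\end{bmatrix}$; (iii) if $A$ contains a $0$ entry and $\beta\in\partial E^\sharp(A)\cap\partial I_{b_u}$, then $t(A)\bigl(|a'\beta'+b'|\lor|c'\beta'+d'|\bigr)>|\beta'|\lor1$. A set $\mathcal B$ of decreasing blocks is complete for $T$ if one of the following holds: $\det A_1=-1$ and every $\mathbf a\in\mathfrak A^\omega$ that does not start with $r$ and does not end with $\overline r=rrr\cdots$ begins with a block in $\mathcal B$; or $\det A_1=+1$ and every $\mathbf a\in\mathfrak A^\omega$ that does not start with $r$ and does not end either with $\overline r$ or with $\overline 1=111\cdots$ begins with a block in $\mathcal B$. *)

(* Defs.v *)
From HB Require Import structures.
From mathcomp Require Import all_boot all_order all_algebra.
From mathcomp Require Import all_classical all_reals all_analysis.

Set Implicit Arguments.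
Unset Strict Implicit.
Unset Printing Implicit Defensive.

Import Order.TTheory GRing.Theory Num.Theory numFieldNormedType.Exports.

Local Open Scope classical_set_scope.
Local Open Scope ring_scope.

(* The real projective line: Some x is the real number x, None is infinity. *)
Notation P1 R := (one_point_compactification R).

Section Definitions.
Context {R : realType}.
Implicit Types (A : 'M[R]_2) (x : R) (D : nat).

(* Elements of PSL_2^{+-} are handled through matrix representatives; every
   notion below is either invariant under A -> - A or is applied to the
   representative with nonnegative entries. *)
Definition mx22 (a b c d : R) : 'M[R]_2 :=
  \matrix_(i < 2, j < 2)
    if i == 0 then (if j == 0 then a else b) else (if j == 0 then c else d).

Definition act A (z : P1 R) : P1 R :=
  let: (num, den) :=
    match z with
    | Some x => (A 0 0 * x + A 0 1, A 1 0 * x + A 1 1)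
    | None => (A 0 0, A 1 0)
    end in
  if den == 0 then None else Some (num / den).

Definition I0 : set (P1 R) :=
  [set z | match z with Some x => 0 <= x | None => True end].

(* Closure and boundary in the subspace topology of [0, oo]. *)
Definition closure_I0 (E : set (P1 R)) : set (P1 R) := @closure (subspace I0) E.
Definition boundary_I0 (E : set (P1 R)) : set (P1 R) :=
  closure_I0 E `\` @interior (subspace I0) E.

(* The nontrivial automorphism of Q(sqrt D) (for D not a square), seen as a
   subfield of R: p + q sqrt D |-> p - q sqrt D. Junk outside Q(sqrt D). *)
Definition conjQ D x : R :=
  let pq := xget (0, 0)
    [set pq : rat * rat | x = ratr pq.1 + ratr pq.2 * Num.sqrt D%:R] in
  ratr pq.1 - ratr pq.2 * Num.sqrt D%:R.

Definition nonneg_positive A : Prop :=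
  (forall i j, 0 <= A i j) /\
  (#|[pred ij : 'I_2 * 'I_2 | A ij.1 ij.2 == 0%R]| <= 1)%N.

Definition fA A (z : P1 R) : R :=
  match z with
  | Some x =>
      Num.max (A 0 0 * x + A 0 1) (A 1 0 * x + A 1 1) / Num.max x 1
  | None => Num.max (A 0 0) (A 1 0)
  end.

Definition tA D A : R :=
  Num.max (`|conjQ D (A 0 0)| + `|conjQ D (A 1 0)|)
          (`|conjQ D (A 0 1)| + `|conjQ D (A 1 1)|).

Definition Esharp D A : set (P1 R) := I0 `&` [set z | tA D A < fA A z].

(* K = Q(sqrt radicand); the alphabet is {1, ..., nletters}, and values of
   branch outside of it are irrelevant. *)
Record algorithm := Algorithm {
  radicand : nat;
  nletters : nat;
  branch : nat -> 'M[R]_2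
}.

Implicit Types (T : algorithm) (b : seq nat).

Definition letter T (a : nat) : bool := (1 <= a <= nletters T)%N.

Definition interval T (a : nat) : set (P1 R) := act (branch T a) @` I0.

(* The points beta of condition (iii) lie in ]0, oo[: neither 0 nor oo can be
   a boundary point, relative to [0, oo], of an interval of a cover of [0, oo]
   by nondegenerate intervals meeting at most in endpoints. *)
Definition decreasing_block T b : Prop :=
  let D := radicand T in
  let u := (size b).-1 in
  let I_bu := interval T (nth 0%N b u) in
  [/\ all (letter T) b,
      (2 <= size b)%N,
      nth 0%N b 0 != nletters T,
      nth 0%N b u != nletters T &
      exists A : 'M[R]_2,
        [/\ A = \prod_(a <- take u b) branch T a \/
            A = - \prod_(a <- take u b) branch T a,
            nonneg_positive A,
            I_bu `<=` closure_I0 (Esharp D A) &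
            (exists i j, A i j = 0) ->
            forall beta : R,
              boundary_I0 (Esharp D A) (Some beta) ->
              boundary_I0 I_bu (Some beta) ->
              Num.max `|conjQ D beta| 1 <
              tA D A *
                Num.max
                  `|conjQ D (A 0 0) * conjQ D beta + conjQ D (A 0 1)|
                  `|conjQ D (A 1 0) * conjQ D beta + conjQ D (A 1 1)|]].

Definition begins_with (a : nat -> nat) b : Prop := mkseq a (size b) = b.

Definition ends_with_constant (a : nat -> nat) (c : nat) : Prop :=
  exists N, forall n, (N <= n)%N -> a n = c.

Definition complete T (B : set (seq nat)) : Prop :=
  (\det (branch T 1) = -1 /\
   forall a : nat -> nat, (forall n, letter T (a n)) ->
     a 0%N <> nletters T ->
     ~ ends_with_constant a (nletters T) ->
     exists2 b, B b & begins_with a b) \/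
  (\det (branch T 1) = 1 /\
   forall a : nat -> nat, (forall n, letter T (a n)) ->
     a 0%N <> nletters T ->
     ~ (ends_with_constant a (nletters T) \/ ends_with_constant a 1) ->
     exists2 b, B b & begins_with a b).

Definition admits_complete_set_of_decreasing_blocks T : Prop :=
  exists B : set (seq nat), B `<=` decreasing_block T /\ complete T B.

Definition lambda (k : nat) : R := 2 * cos (pi / k%:R).

Definition golden : R := (1 + Num.sqrt 5) / 2.

(* Type (l, m, oo). The letter a = (i - 1)(l - 1) + j with 1 <= i < m and
   1 <= j < l is decoded by Euclidean division of a - 1 by l - 1. *)
Definition algI (l m D : nat) : algorithm :=
  let F := mx22 0 1 1 0 in
  let Q := mx22 (lambda l) 1 (-1) 0 in
  let Rm := mx22 0 1 (-1) (lambda m) in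
  Algorithm D ((l - 1) * (m - 1)) (fun a =>
    let i := ((a - 1) %/ (l - 1) + 1)%N in
    let j := ((a - 1) %% (l - 1) + 1)%N in
    if odd a then Rm ^+ i * Q ^+ j * F else Rm ^+ i * Q ^+ j).

(* Type (l, oo, oo). For a = 1 + 2q, 0 <= q <= l - 1, the matrix is (MP)^q M J;
   for a = 2 + 2q, 0 <= q <= l - 2, it is (MP)^(q+1) J. *)
Definition algII (l D : nat) (beta : R) : algorithm :=
  let J := mx22 (-1) 0 0 1 in
  let P := mx22 (-1) 1 0 1 in
  let M := mx22 1 0 beta (-1) in
  Algorithm D (2 * l - 1) (fun a =>
    if odd a then (M * P) ^+ a./2 * M * J else (M * P) ^+ a./2 * J).

(* Type (4, m, oo). The letter a = 3j - 2 + k with 1 <= j <= m - 1 and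
   k = 0, 1, 2 is decoded by Euclidean division of a - 1 by 3. *)
Definition algIII (m D : nat) (alpha beta gamma delta : R) : algorithm :=
  let P x := mx22 (-1) x 0 1 in
  let M x := mx22 1 0 x (-1) in
  let U k :=
    match k with
    | 1%N => P gamma
    | 2%N => P gamma * M delta
    | _ => P gamma * M delta * P gamma
    end in
  let V j :=
    if odd j then (M beta * P alpha) ^+ j./2 * M beta
    else (M beta * P alpha) ^+ j./2 in
  Algorithm D (3 * (m - 1)) (fun a =>
    let j := ((a - 1) %/ 3 + 1)%N in
    let k := ((a - 1) %% 3)%N in
    V j * (if odd j then U (3 - k)%N else U (k + 1)%N)).

End Definitions.

Arguments algorithm R : clear implicits.

(* Main.v *)
(* Put B = all decreasing blocks. The matrices with entries in the integer ring
   Z[w] are computed with exactly, and a finite search shows that every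
   admissible sequence has a decreasing prefix. The search reads the sequence
   letter by letter, except that a maximal run of a parabolic letter (r, and
   also 1 when det A_1 = 1) is read in one step: as A_r = 1 + N with N^2 = 0,
   the possible prefix matrices form a family g + cone(gs), stable under
   multiplication by further letters.

   A word with matrix A followed by the letter c <> r is accepted when, for one
   row (e, f) of A and both columns (x, y) of A_c, e x + f y >= t(A) max(x, y),
   with strict inequality for at least one column. Since t(A) max(x, y) is
   convex and I_c is the cone spanned by the columns of A_c, f_A > t(A) then
   holds on I_c up to one endpoint. By the triangle inequality for the
   conjugate entries it is enough to test the inequality on g and on every
   generator in gs. When A has a zero entry both inequalities are required to
   be strict, so that E^sharp is a neighbourhood of I_c and the boundaries in
   (iii) do not meet. With this criterion the search terminates in all nine
   cases. *)
From Stdlib Require Import ZArith.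
Require Import Defs.
From mathcomp Require Import all_boot all_order all_algebra.
From mathcomp Require Import all_classical all_reals all_analysis.
From mathcomp Require Import zify ssrZ ring lra.

Set Implicit Arguments.
Unset Strict Implicit.
Unset Printing Implicit Defensive.

Import Order.TTheory GRing.Theory Num.Theory numFieldNormedType.Exports.

Local Open Scope classical_set_scope.
Local Open Scope ring_scope.

(* (p, q) stands for p + q w, where w is a root of w ^ 2 = s w + n. *)
Definition qint := (Z * Z)%type.
Definition qmat := ((qint * qint) * (qint * qint))%type.

(** * Exact arithmetic in Z[w] and on matrices over it *)

Section Arithmetic.
Variables s n : Z.
Implicit Types (x y : qint) (A B : qmat).

Definition qadd x y : qint := (Z.add x.1 y.1, Z.add x.2 y.2).
Definition qopp x : qint := (Z.opp x.1, Z.opp x.2).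
Definition qsub x y : qint := (Z.sub x.1 y.1, Z.sub x.2 y.2).
Definition qmul x y : qint :=
  let c := Z.mul x.2 y.2 in
  (Z.add (Z.mul x.1 y.1) (Z.mul n c),
   Z.add (Z.add (Z.mul x.1 y.2) (Z.mul x.2 y.1)) (Z.mul s c)).
Definition qconj x : qint := (Z.add x.1 (Z.mul s x.2), Z.opp x.2).

(* 2 (p + q w) = u + q sqrt(s^2 + 4 n) with u = 2 p + s q. *)
Definition qnonneg x : bool :=
  let u := Z.add (Z.mul 2 x.1) (Z.mul s x.2) in
  let uu := Z.mul u u in
  let vv := Z.mul (Z.add (Z.mul s s) (Z.mul 4 n)) (Z.mul x.2 x.2) in
  if Z.leb 0 x.2 then (if Z.leb 0 u then true else Z.leb uu vv)
  else (if Z.leb 0 u then Z.leb vv uu else false).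
Definition qpos x : bool := ~~ qnonneg (qopp x).
Definition qabs x : qint := if qnonneg x then x else qopp x.
Definition qmax x y : qint := if qnonneg (qsub y x) then y else x.

Definition mone : qmat := (((Zpos 1, Z0), (Z0, Z0)), ((Z0, Z0), (Zpos 1, Z0))).
Definition mopp A : qmat :=
  let: ((a, b), (c, d)) := A in ((qopp a, qopp b), (qopp c, qopp d)).
Definition msub A B : qmat :=
  let: ((a, b), (c, d)) := A in let: ((a', b'), (c', d')) := B in
  ((qsub a a', qsub b b'), (qsub c c', qsub d d')).
Definition mmul A B : qmat :=
  let: ((a, b), (c, d)) := A in let: ((a', b'), (c', d')) := B in
  ((qadd (qmul a a') (qmul b c'), qadd (qmul a b') (qmul b d')),
   (qadd (qmul c a') (qmul d c'), qadd (qmul c b') (qmul d d'))).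
Definition mexp A k : qmat := iter k (mmul^~ A) mone.
Definition mdet A : qint :=
  let: ((a, b), (c, d)) := A in qsub (qmul a d) (qmul b c).
Definition mnonneg A : bool :=
  let: ((a, b), (c, d)) := A in
  [&& qnonneg a, qnonneg b, qnonneg c & qnonneg d].
(** A representative modulo sign: a positive class in PSL is recorded with entries >= 0. *)
Definition mnormal A : qmat := if mnonneg A then A else mopp A.

End Arithmetic.

Arguments mmul : simpl never.

(** * Real values of exact numbers and correctness of the comparisons *)

Section Evaluation.
Context {R : realType}.
Variables s n : Z.

Definition zr (z : Z) : R := (int_of_Z z)%:~R.

Lemma zrD x y : zr (Z.add x y) = zr x + zr y.
Proof. by rewrite /zr -[Z.add x y]/(x + y) rmorphD intrD. Qed.

Lemma zrN x : zr (Z.opp x) = - zr x.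
Proof. by rewrite /zr -[Z.opp x]/(- x) rmorphN intrN. Qed.

Lemma zrB x y : zr (Z.sub x y) = zr x - zr y.
Proof. by rewrite -Z.add_opp_r zrD zrN. Qed.

Lemma zrM x y : zr (Z.mul x y) = zr x * zr y.
Proof. by rewrite /zr -[Z.mul x y]/(x * y) rmorphM intrM. Qed.

Lemma zr_le x y : (zr x <= zr y) = Z.leb x y.
Proof. by rewrite /zr ler_int; lia. Qed.

Lemma zr0 : zr Z0 = 0. Proof. by []. Qed.
Lemma zr1 : zr (Zpos xH) = 1. Proof. by []. Qed.

Definition zrE := (zrD, zrN, zrB, zrM).

Definition qev (w : R) (x : qint) : R := zr x.1 + zr x.2 * w.

Lemma qevD w x y : qev w (qadd x y) = qev w x + qev w y.
Proof. by rewrite /qev !zrE; ring. Qed.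

Lemma qevN w x : qev w (qopp x) = - qev w x.
Proof. by rewrite /qev !zrE; ring. Qed.

Lemma qevB w x y : qev w (qsub x y) = qev w x - qev w y.
Proof. by rewrite /qev !zrE; ring. Qed.

(** When [w] is a root of the polynomial, [s - w] is the other root, so evaluation there is
    conjugation. *)
Lemma qev_conj w x : qev w (qconj s x) = qev (zr s - w) x.
Proof. by rewrite /qev !zrE; ring. Qed.

Definition mev (w : R) (A : qmat) : 'M[R]_2 :=
  let: ((a, b), (c, d)) := A in mx22 (qev w a) (qev w b) (qev w c) (qev w d).

Lemma ord2P (i : 'I_2) : i = 0 \/ i = 1.
Proof. by case: i => [[|[|//]] hi]; [left|right]; apply: val_inj. Qed.

Lemma mx22P (A B : 'M[R]_2) : A 0 0 = B 0 0 -> A 0 1 = B 0 1 ->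
  A 1 0 = B 1 0 -> A 1 1 = B 1 1 -> A = B.
Proof.
move=> h1 h2 h3 h4; apply/matrixP => i j.
by case: (ord2P i) => ->; case: (ord2P j) => ->.
Qed.

Lemma mx22E (a b c d : R) : (mx22 a b c d 0 0 = a) * (mx22 a b c d 0 1 = b) *
  (mx22 a b c d 1 0 = c) * (mx22 a b c d 1 1 = d).
Proof. by rewrite /mx22 !mxE. Qed.

Lemma mulmx22 (A B : 'M[R]_2) i j : (A * B) i j = A i 0 * B 0 j + A i 1 * B 1 j.
Proof.
rewrite mxE big_ord_recl big_ord1.
by congr (_ + A i _ * B _ j); apply: val_inj.
Qed.

Lemma mev1 w : mev w mone = 1.
Proof.
by apply: mx22P; rewrite mx22E /qev /= ?zr0 ?zr1 !mxE /= mul0r addr0.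
Qed.

Lemma mevN w A : mev w (mopp A) = - mev w A.
Proof.
move: A => [[a b] [c d]].
by apply: mx22P; rewrite !mxE /= qevN.
Qed.

Lemma mevB w A B : mev w (msub A B) = mev w A - mev w B.
Proof.
move: A B => [[a b] [c d]] [[a' b'] [c' d']].
by apply: mx22P; rewrite !mxE /= qevB.
Qed.

Variable w : R.
Hypothesis w_root : w * w = zr s * w + zr n.

Lemma qevM x y : qev w (qmul s n x y) = qev w x * qev w y.
Proof.
rewrite /qev /qmul /= !zrE.
transitivity (zr x.1 * zr y.1 + (zr x.1 * zr y.2 + zr x.2 * zr y.1) * w +
  zr x.2 * zr y.2 * (w * w)); last by ring.
by rewrite w_root; ring.
Qed.

Lemma mevM A B : mev w (mmul s n A B) = mev w A * mev w B.
Proof.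
move: A B => [[a b] [c d]] [[a' b'] [c' d']].
by apply: mx22P; rewrite mulmx22 !mx22E qevD !qevM.
Qed.

Lemma mevX A k : mev w (mexp s n A k) = mev w A ^+ k.
Proof.
elim: k => [|k IH]; first by rewrite mev1 expr0.
by rewrite /mexp /= mevM IH exprSr.
Qed.

Lemma det_mx22 (A : 'M[R]_2) : \det A = A 0 0 * A 1 1 - A 0 1 * A 1 0.
Proof.
rewrite (expand_det_row _ 0) big_ord_recl big_ord1 /cofactor !det_mx11 !mxE.
rewrite /= expr0 expr1 mul1r mulN1r mulrN.
by congr (A _ _ * A _ _ - A _ _ * A _ _); apply: val_inj.
Qed.

Lemma mev_det A : \det (mev w A) = qev w (mdet s n A).
Proof.
move: A => [[a b] [c d]].
by rewrite det_mx22 !mx22E qevB !qevM.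
Qed.

Hypothesis w_gt : zr s < 2 * w.

(** By [w_gt], [w] is the larger root and [d = 2 w - s] is the positive square root of s^2 + 4 n.
    When [u] and [q] differ in sign, the sign of [u + q d] is found by comparing u^2 with (q
    d)^2. *)
Lemma qnonnegE x : qnonneg s n x = (0 <= qev w x).
Proof.
case: x => p q; rewrite /qnonneg /qev -[(p, q).1]/p -[(p, q).2]/q.
set u := Z.add _ _; set D := Z.add (Z.mul s s) _.
pose d := 2 * w - zr s.
have d_gt0 : 0 < d by rewrite /d subr_gt0.
have z2 : zr (Zpos 2) = 2 by [].
have z4 : zr (Zpos 4) = 4 by [].
have Dd : zr D = d * d.
  rewrite /D /d !zrE z4.
  transitivity (zr s * zr s + 4 * (w * w - zr s * w)); last by ring.
  by rewrite w_root; ring.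
have -> : (0 <= zr p + zr q * w) = (0 <= zr u + zr q * d).
  have -> : zr u + zr q * d = 2 * (zr p + zr q * w).
    by rewrite /u /d !zrE z2; ring.
  by rewrite pmulr_rge0.

rewrite -!zr_le zr0 !zrM Dd.
have [q_ge0|q_lt0] := leP 0 (zr q).
  have qd_ge0 : 0 <= zr q * d by rewrite mulr_ge0 // ltW.
  have [u_ge0|u_lt0] := leP 0 (zr u); first by rewrite addr_ge0.
  rewrite -[X in _ = (0 <= X + _)]opprK addrC subr_ge0.
  have -> : d * d * (zr q * zr q) = (zr q * d) ^+ 2 by rewrite expr2; ring.
  have -> : zr u * zr u = (- zr u) ^+ 2 by rewrite expr2; ring.
  by rewrite ler_sqr ?nnegrE ?oppr_ge0 // ltW.
have qd_lt0 : zr q * d < 0 by rewrite pmulr_llt0.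
have [u_ge0|u_lt0] := leP 0 (zr u).
  rewrite -[X in _ = (0 <= _ + X)]opprK subr_ge0.
  have -> : d * d * (zr q * zr q) = (- (zr q * d)) ^+ 2 by rewrite expr2; ring.
  have -> : zr u * zr u = (zr u) ^+ 2 by rewrite expr2; ring.
  by rewrite ler_sqr // nnegrE oppr_ge0 ltW.
by apply/esym/negbTE; rewrite -ltNge -[0]addr0 ltrD.
Qed.

Lemma qposE x : qpos s n x = (0 < qev w x).
Proof. by rewrite /qpos qnonnegE qevN oppr_ge0 -ltNge. Qed.

Lemma qabsE x : qev w (qabs s n x) = `|qev w x|.
Proof.
by rewrite /qabs qnonnegE; case: ger0P => // _; rewrite qevN.
Qed.

Lemma qmaxE x y : qev w (qmax s n x y) = Num.max (qev w x) (qev w y).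
Proof. by rewrite /qmax qnonnegE qevB subr_ge0; case: leP. Qed.

End Evaluation.

(** * Intervals as cones and the geometry of E^sharp *)

Section Blocks.
Context {R : realType}.
Implicit Types (A B : 'M[R]_2) (D : nat).

Lemma affine_continuous (a b : R) : continuous (fun x : R => a * x + b).
Proof.
move=> x; apply: (@continuousD _ _ _ (fun x : R => a * x) (cst b)).
  by apply: continuousM; [exact: cst_continuous | exact: cvg_id].
exact: cst_continuous.
Qed.

Lemma fA_continuous A : continuous (fun x : R => fA A (Some x)).
Proof.
move=> x; rewrite /fA; apply: cvgM.
  apply: (@continuous_max R _ (fun y => A 0 0 * y + A 0 1)
    (fun y => A 1 0 * y + A 1 1)); exact: affine_continuous.
apply: cvgV; first by rewrite gt_eqF // lt_max ltr01 orbT.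
apply: (@continuous_max _ _ id (cst 1)); first exact: cvg_id.
exact: cst_continuous.
Qed.

Lemma nbhs_fA_gt A (t x : R) : t < fA A (Some x) ->
  nbhs (Some x : P1 R) [set z | t < fA A z].
Proof.
move=> tx; apply: (@fA_continuous A x [set y | t < y]).
by apply: open_nbhs_nbhs; split => //; exact: open_gt.
Qed.

Lemma nbhs_fA_lt A (t x : R) : fA A (Some x) < t ->
  nbhs (Some x : P1 R) [set z | fA A z < t].
Proof.
move=> tx; apply: (@fA_continuous A x [set y | y < t]).
by apply: open_nbhs_nbhs; split => //; exact: open_lt.
Qed.

(** Passage to homogeneous coordinates (x : y), possible because numerator and denominator of f_A
    both scale linearly. *)
Lemma fA_ratio A (x y : R) : 0 < y ->
  fA A (Some (x / y)) =
  Num.max (A 0 0 * x + A 0 1 * y) (A 1 0 * x + A 1 1 * y) / Num.max x y.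
Proof.
move=> y0; have yi0 : 0 <= y^-1 by rewrite invr_ge0 ltW.
have -> : fA A (Some (x / y)) =
  Num.max ((A 0 0 * x + A 0 1 * y) / y) ((A 1 0 * x + A 1 1 * y) / y) /
  Num.max (x / y) (y / y).
  by rewrite /fA !mulrDl divff ?gt_eqF // -!mulrA divff ?gt_eqF // !mulr1.
rewrite -!maxr_pMl //; field.
by rewrite !gt_eqF // lt_max y0 orbT.
Qed.

Lemma form_le_max A (r : 'I_2) (x y : R) : A r 0 * x + A r 1 * y <=
  Num.max (A 0 0 * x + A 0 1 * y) (A 1 0 * x + A 1 1 * y).
Proof. by rewrite le_max; case: (ord2P r) => ->; rewrite lexx ?orbT. Qed.

Lemma le_fA A (r : 'I_2) (t x y : R) : 0 < y ->
  t * Num.max x y <= A r 0 * x + A r 1 * y -> t <= fA A (Some (x / y)).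
Proof.
move=> y0 h; have m0 : 0 < Num.max x y by rewrite lt_max y0 orbT.
rewrite fA_ratio // ler_pdivlMr //.
exact: le_trans h (form_le_max _ _ _ _).
Qed.

Lemma lt_fA A (r : 'I_2) (t x y : R) : 0 < y ->
  t * Num.max x y < A r 0 * x + A r 1 * y -> t < fA A (Some (x / y)).
Proof.
move=> y0 h; have m0 : 0 < Num.max x y by rewrite lt_max y0 orbT.
rewrite fA_ratio // ltr_pdivlMr //.
exact: lt_le_trans h (form_le_max _ _ _ _).
Qed.

(** The weights (u : v) of the two columns of [B] are homogeneous coordinates on I_0: (x : 1) for
    finite x and (1 : 0) for infinity. *)
Definition cone_pt B (u v : R) : R :=
  (B 0 0 * u + B 0 1 * v) / (B 1 0 * u + B 1 1 * v).

Lemma cone_den_gt0 B (u v : R) : (forall j, 0 < B 1 j) -> 0 <= u -> 0 <= v ->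
  0 < u + v -> 0 < B 1 0 * u + B 1 1 * v.
Proof.
move=> B1 u0 v0 uv.
have [u_eq0|u_neq0] := eqVneq u 0.
  by move: uv; rewrite u_eq0 !add0r mulr0 add0r => ?; rewrite mulr_gt0.
by rewrite ltr_wpDr ?mulr_ge0 ?mulr_gt0 ?B1 // ?(ltW (B1 _)) // lt0r u_neq0.
Qed.

Lemma act_cone B z : (forall j, 0 < B 1 j) -> I0 z ->
  exists u v, [/\ 0 <= u, 0 <= v, 0 < u + v & act B z = Some (cone_pt B u v)].
Proof.
move=> B1; case: z => [x|] /= hx.
  exists x, 1; split => //; first by rewrite ltr_wpDl.
  rewrite /act gt_eqF ?mulr1 /cone_pt ?mulr1 //.
  by rewrite ltr_wpDl ?B1 // mulr_ge0 // ltW.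
exists 1, 0; split; rewrite ?addr0 //.
by rewrite /act gt_eqF ?B1 // /cone_pt !mulr0 !mulr1 !addr0.
Qed.

(** A nonnegative multiple of a maximum of linear forms is convex and homogeneous, so bounds at the
    two columns extend to the cone they span. *)
Lemma cone_max A B (r : 'I_2) (t u v : R) (M : 'I_2 -> R) : 0 <= t ->
  0 <= u -> 0 <= v ->
  (forall j, t * Num.max (B 0 j) (B 1 j) <= M j) ->
  t * Num.max (B 0 0 * u + B 0 1 * v) (B 1 0 * u + B 1 1 * v) <=
  M 0 * u + M 1 * v.
Proof.
move=> t0 u0 v0 h; rewrite maxr_pMr // ge_max.
have hj i j : t * B i j <= M j.
  apply: le_trans (h j); rewrite ler_wpM2l // le_max.
  by case: (ord2P i) => ->; rewrite lexx ?orbT.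
have hu i : t * B i 0 * u <= M 0 * u by rewrite ler_wpM2r.
have hv i : t * B i 1 * v <= M 1 * v by rewrite ler_wpM2r.
by rewrite !mulrDr !mulrA !lerD.
Qed.

Lemma tA_ge0 D A : 0 <= tA D A.
Proof. by rewrite /tA le_max addr_ge0 ?normr_ge0. Qed.

(** Endpoints are approached from inside the cone: adding [e > 0] to both weights makes them
    positive, and the point depends continuously on [e] down to 0. *)
Lemma closure_cone (E : set (P1 R)) B (u v : R) : (forall j, 0 < B 1 j) ->
  0 <= u -> 0 <= v -> 0 < u + v ->
  (forall e, 0 < e -> E (Some (cone_pt B (u + e) (v + e)))) ->
  closure E (Some (cone_pt B u v)).
Proof.
move=> B1 u0 v0 uv hE U nU.
pose f e : R := cone_pt B (u + e) (v + e).
have f0 : f 0 = cone_pt B u v by rewrite /f !addr0.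
have fE : f = fun e => ((B 0 0 + B 0 1) * e + (B 0 0 * u + B 0 1 * v)) /
                       ((B 1 0 + B 1 1) * e + (B 1 0 * u + B 1 1 * v)).
  by apply/funext => e; rewrite /f /cone_pt; congr (_ / _); ring.
have fE0 e : 0 < e -> E (Some (f e)) by exact: hE.
clearbody f.
have cf : f @ 0^'+ --> f 0.
  apply: cvg_at_right_filter; rewrite fE; apply: cvgM.
    exact: affine_continuous.
  apply: cvgV; last exact: affine_continuous.
  by rewrite mulr0 add0r gt_eqF // cone_den_gt0.
have nU' : nbhs (f 0) [set x | U (Some x)] by rewrite f0.
have nearU : \forall e \near 0^'+, U (Some (f e)) by exact: cf _ nU'.
have pos : \forall e \near 0^'+, 0 < e :> R by exact: nbhs_right_gt.
have [e [eU e0]] := filter_ex (filterI nearU pos).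
by exists (Some (f e)); split; [exact: fE0 | exact: eU].
Qed.

Section Dominated.
Variables (D : nat) (A B : 'M[R]_2) (r : 'I_2).
Let L j := A r 0 * B 0 j + A r 1 * B 1 j.
Let m j := Num.max (B 0 j) (B 1 j).
Hypothesis B0_ge0 : forall j, 0 <= B 0 j.
Hypothesis B1_gt0 : forall j, 0 < B 1 j.
Hypothesis dom : forall j, tA D A * m j <= L j.

Lemma cone_pt_ge0 u v : 0 <= u -> 0 <= v -> 0 < u + v -> 0 <= cone_pt B u v.
Proof.
move=> u0 v0 uv; rewrite divr_ge0 ?(ltW (cone_den_gt0 _ _ _ _)) //.
by rewrite addr_ge0 ?mulr_ge0.
Qed.

Lemma form_cone u v : A r 0 * (B 0 0 * u + B 0 1 * v) +
  A r 1 * (B 1 0 * u + B 1 1 * v) = L 0 * u + L 1 * v.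
Proof. by rewrite /L; ring. Qed.

(** The weighted sum of the two column inequalities is strict as soon as a strict column has
    positive weight. *)
Lemma Esharp_cone u v : 0 <= u -> 0 <= v -> 0 < u + v ->
  (0 < u /\ tA D A * m 0 < L 0) \/ (0 < v /\ tA D A * m 1 < L 1) ->
  Esharp D A (Some (cone_pt B u v)).
Proof.
move=> u0 v0 uv str; split; first exact: cone_pt_ge0.
apply: (lt_fA (r := r)); first exact: cone_den_gt0.
rewrite form_cone.
have := @cone_max A B r (tA D A) u v (fun j => tA D A * m j) (tA_ge0 _ _) u0 v0
  (fun j => lexx _).
move/le_lt_trans; apply; case: str => -[w0 w1].
  by rewrite ltr_leD ?ltr_pM2r ?ler_wpM2r.
by rewrite ler_ltD ?ltr_pM2r ?ler_wpM2r.
Qed.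

Lemma subset_closure_Esharp : (exists j, tA D A * m j < L j) ->
  act B @` I0 `<=` closure_I0 (Esharp D A).
Proof.
move=> [j strict] _ [z Iz <-].
have [u [v [u0 v0 uv ->]]] := act_cone B1_gt0 Iz.
rewrite /closure_I0 closure_subspaceW; last by move=> ? [].
split; last exact: cone_pt_ge0.
apply: closure_cone => // e e0; apply: Esharp_cone.
- by rewrite addr_ge0 // ltW.
- by rewrite addr_ge0 // ltW.
- by rewrite addr_gt0 // ltr_wpDl.
by case: (ord2P j) strict => -> strict; [left|right]; rewrite ltr_wpDl.
Qed.

(** Strictness at both columns leaves room for a constant [t > tA D A] with f_A >= t on the
    interval, hence by continuity at every finite point of its closure. Such points are therefore
    interior to E^sharp. *)
Lemma boundary_disjoint (beta : R) : (forall j, tA D A * m j < L j) ->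
  boundary_I0 (Esharp D A) (Some beta) ->
  boundary_I0 (act B @` I0) (Some beta) -> False.
Proof.
move=> strict [_ nint] [clI _]; apply: nint.
have m_gt0 j : 0 < m j by rewrite lt_max B1_gt0 orbT.
have sub : act B @` I0 `<=` I0.
  move=> _ [z Iz <-]; have [u [v [u0 v0 uv ->]]] := act_cone B1_gt0 Iz.
  exact: cone_pt_ge0.
move: clI; rewrite /closure_I0 closure_subspaceW // => -[clI beta0].
have [t tt tL] : exists2 t, tA D A < t & forall j, t * m j <= L j.
  exists (Num.min (L 0 / m 0) (L 1 / m 1)).
    by rewrite lt_min !ltr_pdivlMr // !strict.
  move=> j; rewrite -ler_pdivlMr // ge_min.
  by case: (ord2P j) => ->; rewrite lexx ?orbT.
have tI z : (act B @` I0) z -> t <= fA A z.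
  move=> [z' Iz <-]; have [u [v [u0 v0 uv ->]]] := act_cone B1_gt0 Iz.
  apply: (le_fA (r := r)); first exact: cone_den_gt0.
  rewrite form_cone; apply: cone_max => //.
  exact: le_trans (tA_ge0 _ _) (ltW tt).
have tb : t <= fA A (Some beta).
  rewrite leNgt; apply/negP => /nbhs_fA_lt /clI[z [Iz]].
  by rewrite /= ltNge tI.
apply/(@nbhs_subspace_ex _ I0 (Esharp D A) (Some beta) beta0).
exists [set z | tA D A < fA A z]; first exact: nbhs_fA_gt (lt_le_trans tt tb).
by apply/seteqP; split => z /= [] => [[]|].
Qed.

End Dominated.
End Blocks.

(** * The finite search on families of matrices *)

Section Search.
Variables s n : Z.

(* (g, gs) stands for the matrices g + (nonnegative combination of gs). *)
Definition matfam := (qmat * seq qmat)%type.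

Definition fmul (G : matfam) (B : qmat) : matfam :=
  (mmul s n G.1 B, [seq mmul s n g B | g <- G.2]).

(* If B = 1 + N with N ^ 2 = 0 then g B ^ k = g + k g N. *)
Definition fstar (G : matfam) (B : qmat) : matfam :=
  let N := msub B mone in
  (G.1, G.2 ++ [seq mmul s n g N | g <- G.1 :: G.2]).

Definition tbound (g : qmat) : qint :=
  let: ((a, b), (c, d)) := g in
  qmax s n (qadd (qabs s n (qconj s a)) (qabs s n (qconj s c)))
           (qadd (qabs s n (qconj s b)) (qabs s n (qconj s d))).

Definition rowval (top : bool) (g : qmat) (p q : qint) : qint :=
  let: ((a, b), (c, d)) := g in
  if top then qadd (qmul s n a p) (qmul s n b q)
  else qadd (qmul s n c p) (qmul s n d q).

Definition slack (top : bool) (p q : qint) (gt : qmat * qint) : qint :=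
  qsub (rowval top gt.1 p q) (qmul s n gt.2 (qmax s n p q)).

Definition zeros (g : qmat) : nat :=
  let: ((a, b), (c, d)) := g in
  (~~ qpos s n a + ~~ qpos s n b + (~~ qpos s n c + ~~ qpos s n d))%N.

(** The bound is stored with the matrix so that it can be shared by all letters tested against the
    same family. *)
Definition with_bound (g : qmat) : qmat * qint := (g, tbound g).

Definition row_dominates (G : matfam) (tgs : seq (qmat * qint)) (top : bool)
    (B : qmat) : bool :=
  let: ((p, p'), (q, q')) := B in
  if all (fun gt => qnonneg s n (slack top p q gt)) tgs then
    if all (fun gt => qnonneg s n (slack top p' q' gt)) tgs then
      let strict := qpos s n (slack top p q (head (with_bound G.1) tgs)) in
      let strict' := qpos s n (slack top p' q' (head (with_bound G.1) tgs)) in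
      if zeros G.1 == 0%N then strict || strict' else strict && strict'
    else false
  else false.

(** Only the zeros of the base are counted: entries of a member are at least those of the base, so a
    member has no zeros elsewhere. *)
Definition positive_family (G : matfam) : bool :=
  all (mnonneg s n) (G.1 :: G.2) && (zeros G.1 <= 1)%N.

(** A positive bottom row keeps infinity out of the interval; [table_ok] exempts only the last
    letter. *)
Definition finite_interval (B : qmat) : bool :=
  let: ((p, p'), (q, q')) := B in
  [&& qnonneg s n p, qnonneg s n p', qpos s n q & qpos s n q'].

Definition dominates (G : matfam) (tgs : seq (qmat * qint)) (B : qmat) : bool :=
  if row_dominates G tgs true B then true else row_dominates G tgs false B.

Variables (last_letter : nat) (table : seq (nat * qmat)) (stars : seq nat).

(* [excluded] is a letter that cannot come next, and 0 when there is none. *)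
Fixpoint covered (fuel : nat) (G : matfam) (excluded : nat) : bool :=
  if fuel is fuel'.+1 then
    let tgs := map with_bound (G.1 :: G.2) in
    let ok := positive_family G in
    all (fun cB : nat * qmat =>
      if cB.1 == excluded then true else
      if (if ok then
            if cB.1 == last_letter then false else dominates G tgs cB.2
          else false) then true else
      let G' := fmul G cB.2 in
      if cB.1 \in stars then covered fuel' (fstar G' cB.2) cB.1
      else covered fuel' G' 0%N) table
  else false.

Definition covered_from_start (fuel : nat) : bool :=
  all (fun cB : nat * qmat =>
    if cB.1 == last_letter then true else
    if cB.1 \in stars then covered fuel (fstar (cB.2, [::]) cB.2) cB.1
    else covered fuel (cB.2, [::]) 0%N) table.

(** [msub mone mone] is the zero matrix: starred letters must be unipotent, which makes their powers
    affine in the exponent. *)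
Definition table_ok : bool :=
  all (fun cB : nat * qmat =>
    ((cB.1 == last_letter) || finite_interval cB.2) &&
    ((cB.1 \in stars) ==>
       (mmul s n (msub cB.2 mone) (msub cB.2 mone) == msub mone mone))) table.

End Search.

(** * Soundness of the families and of the acceptance test *)

Section Soundness.
Context {R : realType}.
Variables (s n : Z) (w : R) (D : nat).
Hypothesis w_root : w * w = zr s * w + zr n.
Hypothesis w_gt : zr s < 2 * w.
Hypothesis conjQ_qev : forall x, conjQ D (qev w x) = qev (zr s - w) x.

Let w' := zr s - w.

Lemma w'_root : w' * w' = zr s * w' + zr n.
Proof.
rewrite /w'; transitivity (zr s * zr s - 2 * zr s * w + w * w); first by ring.
by rewrite w_root; ring.
Qed.

(** The trace pairing represents every real linear functional on pairs of a matrix and its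
    conjugate. *)
Definition lin (X Y : 'M[R]_2) (g : qmat) : R :=
  \tr (X * mev w g) + \tr (Y * mev w' g).

(* By duality, z lies in g + cone(gs) iff every linear functional that is
   nonnegative on gs is at least as large at z as at g; a matrix and its
   conjugate have to be taken together, since conjugation is not R-linear. *)
Definition in_family (G : matfam) (z : qmat) : Prop :=
  forall X Y, (forall g, g \in G.2 -> 0 <= lin X Y g) ->
    lin X Y G.1 <= lin X Y z.

(** Cyclicity of the trace moves right multiplication by [B] onto the functional; hence families are
    stable under appending a letter. *)
Lemma lin_mul X Y g B :
  lin X Y (mmul s n g B) = lin (mev w B * X) (mev w' B * Y) g.
Proof.
have trC (A C : 'M[R]_2) : \tr (A * C) = \tr (C * A) by exact: mxtrace_mulC.
rewrite /lin (mevM w_root) (mevM w'_root) !mulrA.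
by rewrite trC mulrA [X in _ + X]trC mulrA.
Qed.

Lemma in_family_mul G z B : in_family G z ->
  in_family (fmul s n G B) (mmul s n z B).
Proof.
move=> Gz X Y h; rewrite /= !lin_mul; apply: Gz => g gG.
by rewrite -lin_mul; apply: h; apply: map_f.
Qed.

Lemma in_family_star G z B : in_family G z -> in_family (fstar s n G B) z.
Proof.
by move=> Gz X Y h; apply: Gz => g gG; apply: h; rewrite mem_cat gG.
Qed.

(** Since z B - z = z N, it suffices that the functional is nonnegative at z N. Precomposed with
    right multiplication by N, it is nonnegative on the old generators, because each g N is a
    generator too, and it vanishes on the new ones, because N^2 = 0. Membership of z then bounds its
    value at z N below by the value at the generator [G.1] N. *)
Lemma star_step G z B :
  mmul s n (msub B mone) (msub B mone) = msub mone mone ->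
  in_family (fstar s n G B) z -> in_family (fstar s n G B) (mmul s n z B).
Proof.
set N := msub B mone => NN Gz X Y h; apply: (le_trans (Gz X Y h)).
rewrite -subr_ge0 /=.
have -> : lin X Y (mmul s n z B) - lin X Y z = lin X Y (mmul s n z N).
  rewrite /lin /N !(mevM w_root) !(mevM w'_root) !mevB !mev1 !mulrBr !mulr1.
  by rewrite !linearB /=; ring.
have hN g : g \in G.1 :: G.2 -> 0 <= lin X Y (mmul s n g N).
  move=> gG; apply: h; rewrite mem_cat; apply/orP; right.
  exact: (map_f (fun g => mmul s n g N) gG).
apply: (le_trans (hN G.1 (mem_head _ _))).
rewrite !lin_mul; apply: Gz => g; rewrite mem_cat => /orP[gG|/mapP[g' _ ->]].
  by rewrite -lin_mul hN // in_cons gG orbT.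
rewrite lin_mul !mulrA -(mevM w_root) -(mevM w'_root) NN !mevB !subrr !mul0r.
by rewrite /lin !mul0r !linear0 addr0.
Qed.

Lemma mxtrace22 (A : 'M[R]_2) : \tr A = A 0 0 + A 1 1.
Proof.
by rewrite /mxtrace big_ord_recl big_ord1; congr (_ + A _ _); apply: val_inj.
Qed.

Lemma lin_row (top : bool) (P Q : R) p q g : P = qev w p -> Q = qev w q ->
  \tr ((if top then mx22 P 0 Q 0 else mx22 0 P 0 Q) * mev w g) =
  qev w (rowval s n top g p q).
Proof.
move=> -> ->; move: g => [[a b] [c d]].
by case: top; rewrite mxtrace22 !mulmx22 /= !mx22E qevD !(qevM w_root); ring.
Qed.

Lemma lin_col (fst_col : bool) (x y : R) g :
  \tr ((if fst_col then mx22 x y 0 0 else mx22 0 0 x y) * mev w' g) =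
  let: ((a, b), (c, d)) := g in
  if fst_col then x * qev w' a + y * qev w' c else x * qev w' b + y * qev w' d.
Proof.
move: g => [[a b] [c d]].
by case: fst_col; rewrite mxtrace22 !mulmx22 /= !mx22E; ring.
Qed.

Lemma qev_tbound a b c d : qev w (tbound s n ((a, b), (c, d))) =
  Num.max (`|qev w' a| + `|qev w' c|) (`|qev w' b| + `|qev w' d|).
Proof.
by rewrite /tbound (qmaxE w_root w_gt) !qevD !(qabsE w_root w_gt) !qev_conj.
Qed.

Lemma tA_mev z : tA D (mev w z) = qev w (tbound s n z).
Proof.
by move: z => [[a b] [c d]]; rewrite /tA qev_tbound !mx22E !conjQ_qev.
Qed.

(** A supporting functional of the absolute value: it touches at [x] and lies below everywhere. *)
Lemma norm_witness (x : R) :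
  exists2 e, `|x| = e * x & forall y : R, e * y <= `|y|.
Proof.
exists (Num.sg x); first exact: normrEsg.
move=> y; apply: le_trans (ler_norm _) _; rewrite normrM -[leRHS]mul1r.
by rewrite ler_wpM2r // normr_sg lern1 leq_b1.
Qed.

(** The bound t is a maximum, over columns and signs, of linear functionals of the conjugate
    entries. For either column, the signs of the entries of z give a linear functional that
    dominates the slack at every matrix, so it is nonnegative on the generators and membership of z
    applies. Taking the larger of the two column sums at z recovers its slack. *)
Lemma slack_le top p q G z : in_family G z -> 0 <= qev w (qmax s n p q) ->
  (forall g, g \in G.1 :: G.2 ->
     0 <= qev w (slack s n top p q (with_bound s n g))) ->
  qev w (slack s n top p q (with_bound s n G.1)) <=
  qev w (slack s n top p q (with_bound s n z)).
Proof.
move=> Gz; set M := qev w _ => M0 slack_ge0.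
pose X : 'M[R]_2 := if top then mx22 (qev w p) 0 (qev w q) 0
                 else mx22 0 (qev w p) 0 (qev w q).
move: z Gz => [[a b] [c d]]; set z := ((a, b), (c, d)) => Gz.
have key fst_col : qev w (slack s n top p q (with_bound s n G.1)) <=
    qev w (rowval s n top z p q) - M *
    (if fst_col then `|qev w' a| + `|qev w' c| else `|qev w' b| + `|qev w' d|).
  have [e1 e1z e1le] := norm_witness (if fst_col then qev w' a else qev w' b).
  have [e2 e2z e2le] := norm_witness (if fst_col then qev w' c else qev w' d).
  pose Y : 'M[R]_2 := if fst_col then mx22 (- M * e1) (- M * e2) 0 0
                   else mx22 0 0 (- M * e1) (- M * e2).
  have linE g : lin X Y g = qev w (rowval s n top g p q) - M *
      (let: ((a, b), (c, d)) := g in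
       if fst_col then e1 * qev w' a + e2 * qev w' c
       else e1 * qev w' b + e2 * qev w' d).
    rewrite /lin (lin_row _ (p := p) (q := q)) // lin_col.
    by move: g => [[? ?] [? ?]]; case: (fst_col); ring.
  have slack_lin g :
      qev w (slack s n top p q (with_bound s n g)) <= lin X Y g.
    rewrite linE /slack qevB lerD2l lerN2 (qevM w_root) [leRHS]mulrC.
    apply: (ler_wpM2l M0).
    move: g => [[a' b'] [c' d']]; rewrite qev_tbound le_max.
    move: e1le e2le; case: (fst_col) => h1 h2; apply/orP.
      by left; exact: lerD.
    by right; exact: lerD.
  apply: le_trans (slack_lin _) _.
  have := Gz X Y; rewrite (linE z) => h; apply: le_trans (h _) _; last first.
    by move: e1z e2z; rewrite /z; case: (fst_col) => -> ->.
  move=> g gG; apply: le_trans (slack_lin g); apply: slack_ge0.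
  by rewrite in_cons gG orbT.
rewrite [leRHS](_ : _ = qev w (rowval s n top z p q) -
  M * qev w (tbound s n z)); last by rewrite /slack qevB (qevM w_root) mulrC.
have := key true; have := key false.
by rewrite qev_tbound; case: (leP (`|qev w' a| + `|qev w' c|)) => _.
Qed.

Lemma rowval_le top p q G z : in_family G z ->
  (forall g, g \in G.2 -> 0 <= qev w (rowval s n top g p q)) ->
  qev w (rowval s n top G.1 p q) <= qev w (rowval s n top z p q).
Proof.
move=> Gz h; pose X : 'M[R]_2 := if top then mx22 (qev w p) 0 (qev w q) 0
                 else mx22 0 (qev w p) 0 (qev w q).
have linE g : lin X 0 g = qev w (rowval s n top g p q).
  by rewrite /lin (lin_row _ (p := p) (q := q)) // mul0r linear0 addr0.
by rewrite -!linE; apply: Gz => g gG; rewrite linE h.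
Qed.

Lemma mev_entry (g : qmat) i j : mev w g i j = qev w (rowval s n (i == 0) g
  (if j == 0 then (Zpos xH, Z0) else (Z0, Z0))
  (if j == 0 then (Z0, Z0) else (Zpos xH, Z0))).
Proof.
have e0 : qev w (Z0, Z0) = 0 by rewrite /qev zr0 mul0r addr0.
have e1 : qev w (Zpos xH, Z0) = 1 by rewrite /qev zr0 zr1 mul0r addr0.
move: g => [[a b] [c d]].
case: (ord2P i) => ->; case: (ord2P j) => -> /=;
  rewrite mx22E qevD !(qevM w_root);
  by rewrite e0 e1 !(mulr0, mulr1, addr0, add0r).
Qed.

Lemma mnonnegP g : mnonneg s n g -> forall i j, 0 <= mev w g i j.
Proof.
move: g => [[a b] [c d]] /and4P[].
rewrite !(qnonnegE w_root w_gt) => ? ? ? ? i j.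
by case: (ord2P i) => ->; case: (ord2P j) => ->; rewrite mx22E.
Qed.

Lemma mev_le G z i j : in_family G z -> all (mnonneg s n) G.2 ->
  mev w G.1 i j <= mev w z i j.
Proof.
move=> Gz /allP h; rewrite !mev_entry; apply: rowval_le => // g /h gnn.
by rewrite -mev_entry; exact: mnonnegP.
Qed.

Lemma zerosE g : mnonneg s n g ->
  zeros s n g = (\sum_(i < 2) \sum_(j < 2) (mev w g i j == 0%R))%N.
Proof.
move=> /mnonnegP; move: g => [[a b] [c d]] h.
rewrite !big_ord_recl !big_ord0 !addn0 /zeros !(qposE w_root w_gt) -!leNgt.
have le0 i j :
    (mev w ((a, b), (c, d)) i j <= 0) = (mev w ((a, b), (c, d)) i j == 0).
  by rewrite eq_le h andbT.
have o1 : lift ord0 ord0 = 1 :> 'I_2 by apply: val_inj.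
by rewrite o1 -!le0 !mx22E.
Qed.

Lemma positive_in_family G z : positive_family s n G -> in_family G z ->
  nonneg_positive (mev w z).
Proof.
move=> /andP[/= /andP[G1nn nn] z1] Gz.
have le1 i j := mev_le i j Gz nn.
split=> [i j|]; first exact: le_trans (mnonnegP G1nn i j) (le1 i j).
apply: leq_trans z1; rewrite zerosE // -sum1_card big_mkcond /=.
rewrite -(pair_bigA _ (fun i j => if mev w z i j == 0%R then 1 else 0)%N) /=.
apply: leq_sum => i _; apply: leq_sum => j _.
case: eqP => // zij; have := le1 i j; rewrite zij => g0.
by rewrite eq_le g0 (mnonnegP G1nn).
Qed.

(** The last clause makes condition (iii) vacuous: if the matrix has a zero entry, the two
    boundaries share no finite point. *)
Lemma dominates_sound G z B : in_family G z -> positive_family s n G ->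
  finite_interval s n B ->
  dominates s n G (map (with_bound s n) (G.1 :: G.2)) B ->
  [/\ nonneg_positive (mev w z),
      act (mev w B) @` I0 `<=` closure_I0 (Esharp D (mev w z)) &
      (exists i j, mev w z i j = 0) -> forall beta : R,
        boundary_I0 (Esharp D (mev w z)) (Some beta) ->
        boundary_I0 (act (mev w B) @` I0) (Some beta) -> False].
Proof.
move=> Gz pos; move: B => [[p p'] [q q']] /and4P[].
rewrite !(qnonnegE w_root w_gt) !(qposE w_root w_gt) => p0 p'0 q0 q'0 domG.
have [top {}domG] : exists top, row_dominates s n G
    (map (with_bound s n) (G.1 :: G.2)) top ((p, p'), (q, q')).
  by move: domG; rewrite /dominates; case: ifP => h; [exists true|exists false].
move: domG; rewrite /row_dominates.
case: ifP => // /allP h0; case: ifP => // /allP h1 strict.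
set B : qmat := ((p, p'), (q, q')).
pose r : 'I_2 := if top then 0 else 1.
have B0 j : 0 <= mev w B 0 j by case: (ord2P j) => ->; rewrite mx22E.
have B1 j : 0 < mev w B 1 j by case: (ord2P j) => ->; rewrite mx22E.
pose col (j : 'I_2) : qint * qint := if j == 0 then (p, q) else (p', q').
pose sl j g := qev w (slack s n top (col j).1 (col j).2 (with_bound s n g)).
have sl_ge0 j g : g \in G.1 :: G.2 -> 0 <= sl j g.
  move=> gG; rewrite -(qnonnegE w_root w_gt).
  by case: (ord2P j) => -> /=; [apply: h0 | apply: h1]; exact: map_f.
have slE j : sl j z = (mev w z r 0 * mev w B 0 j + mev w z r 1 * mev w B 1 j) -
    tA D (mev w z) * Num.max (mev w B 0 j) (mev w B 1 j).
  rewrite tA_mev /sl /slack qevB (qevM w_root) (qmaxE w_root w_gt).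
  congr (_ - _).
    rewrite /r; case: (z) => [[a b] [c d]].
    by case: (ord2P j) => -> /=; case: (top);
      rewrite /= !mx22E qevD !(qevM w_root).
  by case: (ord2P j) => -> /=; rewrite !mx22E.
have sl_le j : sl j G.1 <= sl j z.
  apply: slack_le => //; last by move=> g; exact: sl_ge0.
  rewrite (qmaxE w_root w_gt) le_max.
  by case: (ord2P j) => -> /=; rewrite ?p0 ?p'0.
have dom j : tA D (mev w z) * Num.max (mev w B 0 j) (mev w B 1 j) <=
    mev w z r 0 * mev w B 0 j + mev w z r 1 * mev w B 1 j.
  rewrite -subr_ge0 -slE; apply: le_trans (sl_le j).
  by apply: sl_ge0; exact: mem_head.
have sdom j : 0 < sl j G.1 ->
    tA D (mev w z) * Num.max (mev w B 0 j) (mev w B 1 j) <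
    mev w z r 0 * mev w B 0 j + mev w z r 1 * mev w B 1 j.
  by move=> h; rewrite -subr_gt0 -slE; apply: lt_le_trans (sl_le j).
move: strict.
rewrite !(qposE w_root w_gt) /= -/(sl 0 G.1) -/(sl 1 G.1) => strict.
have nnp := positive_in_family pos Gz.
split=> //.
  apply: (subset_closure_Esharp (r := r)) => //.
  by case: ifP strict => _ => [/orP[]|/andP[]] h; [exists 0|exists 1|exists 0];
    exact: sdom.
move=> [i [j zij]] beta.
apply: (boundary_disjoint (r := r)) => // j'; apply: sdom.
(* A zero entry of z forces one of [G.1] at the same place, so the test was made in its doubly
   strict form. *)
move: strict; case: ifP => [|_ /andP[]]; last by case: (ord2P j') => ->.
have /andP[/= /andP[G1nn nn] _] := pos.
have G0 : mev w G.1 i j == 0.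
  by rewrite eq_le (mnonnegP G1nn) andbT -zij; exact: mev_le.
by rewrite zerosE // (bigD1 i) //= (bigD1 j) //= G0.
Qed.

Lemma act_opp (A : 'M[R]_2) z : act (- A) z = act A z.
Proof.
case: z => [x|]; rewrite /act !mxE; last by rewrite oppr_eq0 invrN mulrNN.
by rewrite !mulNr -!opprD oppr_eq0 invrN mulrNN.
Qed.

(** * Following an infinite sequence through the search *)

Section Coverage.
Variables (T : algorithm R) (lt : nat -> qmat) (stars : seq nat) (fuel : nat).
Hypothesis radicandT : radicand T = D.
Hypothesis branchT : forall c, letter T c ->
  branch T c = mev w (lt c) \/ branch T c = - mev w (lt c).
Let r := nletters T.
Let table := [seq (c, lt c) | c <- iota 1 r].
Hypothesis tableT : table_ok s n r table stars.

Variable a : nat -> nat.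
Hypothesis a_letter : forall k, letter T (a k).
Hypothesis a0 : a 0%N <> r.
Hypothesis a_stars : forall c, c \in stars -> ~ ends_with_constant a c.

Fixpoint zprefix (k : nat) : qmat :=
  if k is k'.+1 then mmul s n (zprefix k') (lt (a k')) else mone.

Lemma zprefixE k :
  mev w (zprefix k) = \prod_(c <- mkseq a k) branch T c \/
  mev w (zprefix k) = - \prod_(c <- mkseq a k) branch T c.
Proof.
elim: k => [|k IH]; first by left; rewrite big_nil mev1.
rewrite mkseqS -cats1 big_cat big_seq1 /= (mevM w_root).
by case: IH => ->; case: (branchT (a_letter k)) => ->;
  rewrite ?mulrN ?mulNr ?opprK; [left|right|right|left].
Qed.

Lemma mem_table k : (a k, lt (a k)) \in table.
Proof.
by apply/map_f; rewrite mem_iota add1n ltnS; exact: a_letter.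
Qed.

Lemma block_of_dominates G u : (0 < u)%N -> in_family G (zprefix u) ->
  a u <> r -> positive_family s n G ->
  dominates s n G (map (with_bound s n) (G.1 :: G.2)) (lt (a u)) ->
  decreasing_block T (mkseq a u.+1).
Proof.
move=> u0 Gz au pos dom.
have fin : finite_interval s n (lt (a u)).
  have /andP[/orP[/eqP//|//]] := allP tableT _ (mem_table u).
have [nnp sub bnd] := dominates_sound Gz pos fin dom.
have intE : Defs.interval T (a u) = act (mev w (lt (a u))) @` I0.
  rewrite /Defs.interval; case: (branchT (a_letter u)) => -> //.
  by congr image; apply/funext => z; exact: act_opp.
split.
- by apply/allP => c /mapP[k _ ->]; exact: a_letter.
- by rewrite size_mkseq ltnS.
- by rewrite nth_mkseq //; exact/eqP.
- by rewrite size_mkseq nth_mkseq //; exact/eqP.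
rewrite size_mkseq nth_mkseq //.
rewrite mkseqS -cats1 take_size_cat ?size_mkseq //= intE.
exists (mev w (zprefix u)); rewrite radicandT; split=> //.
  by case: (zprefixE u) => ->; [left|right].
by move=> z0 beta /(bnd z0) h /h.
Qed.

(** The sequence is not eventually [c], so the run of [c] ends; until then [star_step] keeps each
    prefix in the family. *)
Lemma star_run G c k : c \in stars -> (c, lt c) \in table ->
  in_family (fstar s n G (lt c)) (zprefix k) ->
  exists k', [/\ (k <= k')%N, a k' <> c &
    in_family (fstar s n G (lt c)) (zprefix k')].
Proof.
move=> cs ct; have [m [km amc]] : exists m, (k <= m)%N /\ a m <> c.
  apply/not_existsP => h; apply: (a_stars cs); exists k => m km.
  by apply: contrapT => amc; apply: (h m).
have NN : mmul s n (msub (lt c) mone) (msub (lt c) mone) = msub mone mone.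
  by have /andP[_ /implyP/(_ cs)/eqP] := allP tableT _ ct.
(* The index m only bounds the run: the induction on m - k stops at the first letter other than
   [c]. *)
rewrite -(subnKC km) in amc; move: (m - k)%N amc => i {m km}.
elim: i k => [|i IH] k; first by rewrite addn0 => akc Gk; exists k.
have [akc|/eqP akc _ Gk] := eqVneq (a k) c; last by exists k.
rewrite addnS -addSn => /IH{}IH Gk.
have [|k' [kk' ak' Gk']] := IH.
  by rewrite /= akc; exact: star_step.
by exists k'; split=> //; exact: ltnW.
Qed.

(** Induction on the fuel: an accepted letter completes a block, and a rejected one is appended,
    together with the rest of its run if it is starred. *)
Lemma covered_sound f G excluded u : covered s n r table stars f G excluded ->
  (0 < u)%N -> in_family G (zprefix u) -> a u <> excluded ->
  exists m, decreasing_block T (mkseq a m).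
Proof.
elim: f G excluded u => // f IH G excluded u /allP/(_ _ (mem_table u)) /=.
move=> + u0 Gz /eqP/negbTE au; rewrite au.
case: ifP => [+ _|_].
  case: ifP => // pos; case: eqP => // aur dom.
  by exists u.+1; exact: (block_of_dominates (G := G)).
have Gz' : in_family (fmul s n G (lt (a u))) (zprefix u.+1).
  exact: in_family_mul.
case: ifP => [cs cov|_ cov].
  have [k [uk ak Gk]] := star_run cs (mem_table u)
    (@in_family_star _ _ (lt (a u)) Gz').
  exact: IH cov (leq_trans _ uk) Gk ak.
apply: IH cov _ Gz' _ => //.
(* Letters start at 1, so the value 0 excludes nothing. *)
by have /andP[h _] := a_letter u.+1; apply/eqP; rewrite -lt0n.
Qed.

Lemma covered_from_start_sound : covered_from_start s n r table stars fuel ->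
  exists m, decreasing_block T (mkseq a m).
Proof.
move=> /allP/(_ _ (mem_table 0)) /=.
move/eqP/negbTE: a0 => ->.
(* [zprefix 1] is the first letter multiplied on the left by [mone]; the two are identified through
   their real values. *)
have mul1m g : in_family (g, [::]) (mmul s n mone g).
  move=> X Y _.
  by rewrite /lin (mevM w_root) (mevM w'_root) !mev1 !mul1r.
case: ifP => [cs cov|_ cov].
  have [k [uk ak Gk]] := star_run (k := 1) cs (mem_table 0)
    (@in_family_star _ _ (lt (a 0%N)) (mul1m (lt (a 0%N)))).
  exact: covered_sound cov uk Gk ak.
apply: (covered_sound (u := 1) cov) => //.
by have /andP[h _] := a_letter 1; apply/eqP; rewrite -lt0n.
Qed.

End Coverage.

Definition check (lt : nat -> qmat) (r : nat) (stars : seq nat) (fuel : nat) :=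
  let table := [seq (c, lt c) | c <- iota 1 r] in
  table_ok s n r table stars && covered_from_start s n r table stars fuel.

Lemma complete_of_check (T : algorithm R) (lt : nat -> qmat) (flip : bool)
    (fuel : nat) :
  radicand T = D ->
  (forall c, letter T c ->
    branch T c = mev w (lt c) \/ branch T c = - mev w (lt c)) ->
  (0 < nletters T)%N ->
  mdet s n (lt 1%N) = ((if flip then Zneg xH else Zpos xH), Z0) ->
  check lt (nletters T)
    (if flip then [:: nletters T] else [:: nletters T; 1%N])
    fuel ->
  admits_complete_set_of_decreasing_blocks T.
Proof.
move=> radT brT r0 det1 /andP[tab cov].
exists (decreasing_block T); split=> //.
have detT : \det (branch T 1) = if flip then -1 else 1.
  have -> : \det (branch T 1) = \det (mev w (lt 1)).
    by case: (brT 1%N) => [|->|->] //;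
      rewrite !det_mx22 !mxE mulrNN [in X in _ - X]mulrNN.
  rewrite (mev_det w_root) det1 /qev zr0 mul0r addr0.
  by case: (flip).
have reach a : (forall k, letter T (a k)) -> a 0%N <> nletters T ->
    (forall c, c \in (if flip then [:: nletters T] else [:: nletters T; 1%N]) ->
      ~ ends_with_constant a c) ->
    exists2 b, decreasing_block T b & begins_with a b.
  move=> al a0 ast.
  have [m hm] := covered_from_start_sound radT brT tab al a0 ast cov.
  by exists (mkseq a m) => //; rewrite /begins_with size_mkseq.
rewrite /complete detT; case: (flip) reach => reach; [left|right];
  split=> // a al a0.
  by move=> na; apply: reach => // c; rewrite inE => /eqP ->.
move=> na; apply: reach => // c; rewrite !inE => /orP[] /eqP -> h; apply: na;
  by [left|right].
Qed.

End Soundness.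

(** * Closed forms of 2 cos(pi / k) *)

Section Trigonometry.
Context {R : realType}.

Lemma cos_mul2 (x : R) : cos (2 * x) = 2 * cos x ^+ 2 - 1.
Proof. by rewrite mulr_natl cos_mulr2n mulr_natl. Qed.

Lemma cos_mul3 (x : R) : cos (3 * x) = 4 * cos x ^+ 3 - 3 * cos x.
Proof.
rewrite (_ : 3 * x = 2 * x + x); last by ring.
rewrite cosD cos_mul2 [2 * x]mulr_natl sin_mulr2n.
transitivity (2 * cos x ^+ 3 - cos x - 2 * cos x * sin x ^+ 2); first by ring.
by rewrite sin2cos2; ring.
Qed.

Lemma cos_piB (x : R) : cos (pi - x) = - cos x.
Proof. by rewrite cosB cospi sinpi mulN1r mul0r addr0. Qed.

Lemma lambda_gt0 k : (2 < k)%N -> 0 < lambda k :> R.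
Proof.
move=> k2; have k0 : 0 < k%:R :> R by rewrite ltr0n; case: k k2.
rewrite /lambda mulr_gt0 // cos_gt0_pihalf //; apply/andP; split.
  by apply: (@lt_trans _ _ 0); rewrite ?oppr_lt0 divr_gt0 ?pi_gt0.
by rewrite ltr_pM2l ?pi_gt0 // ltf_pV2 ?posrE // ltr_nat.
Qed.

Lemma lambda2 : lambda 2 = 0 :> R.
Proof. by rewrite /lambda cos_pihalf mulr0. Qed.

(** With c = cos(pi / 3), the relation 2 pi / 3 = pi - pi / 3 gives (2 c - 1)(c + 1) = 0, and c is
    positive. *)
Lemma lambda3 : lambda 3 = 1 :> R.
Proof.
have := @lambda_gt0 3 isT; have : cos (2 * (pi / 3)) = - cos (pi / 3) :> R.
  by rewrite -cos_piB; congr cos; field.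
rewrite cos_mul2 /lambda; set c := cos _ => h c0.
have : (2 * c - 1) * (c + 1) = 0 
  by transitivity (2 * c ^+ 2 - 1 + c); [ring | rewrite h addNr].
move/eqP; rewrite mulf_eq0 => /orP[|] /eqP h'; lra.
Qed.

Lemma lambda4 : lambda 4 = Num.sqrt 2 :> R.
Proof.
have := @lambda_gt0 4 isT; have : cos (2 * (pi / 4)) = 0 :> R.
  by rewrite -[RHS]cos_pihalf; congr cos; field.
rewrite cos_mul2 /lambda; set c := cos _ => h c0.
have e : 2 = (2 * c) ^+ 2.
  by transitivity (2 * (2 * c ^+ 2 - 1) + 2); [rewrite h; ring | ring].
by rewrite [in RHS]e sqrtr_sqr gtr0_norm.
Qed.

(** With c = cos(pi / 5), the relation 3 pi / 5 = pi - 2 pi / 5 gives (c + 1)(4 c^2 - 2 c - 1) = 0,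
    and positivity selects the root (1 + sqrt 5) / 4. *)
Lemma lambda5 : lambda 5 = golden :> R.
Proof.
have := @lambda_gt0 5 isT.
have : cos (3 * (pi / 5)) = - cos (2 * (pi / 5)) :> R.
  by rewrite -cos_piB; congr cos; field.
rewrite cos_mul3 cos_mul2 /lambda /golden; set c := cos _ => h c0.
have s5 : 1 < Num.sqrt 5 :> R by rewrite -[ltLHS]sqrtr1 ltr_sqrt // ltr1n.
have q5 : Num.sqrt 5 ^+ 2 = 5 :> R by rewrite sqr_sqrtr.
have : (c + 1) * ((4 * c - 1 - Num.sqrt 5) * (4 * c - 1 + Num.sqrt 5)) = 0.
  transitivity (4 * ((4 * c ^+ 3 - 3 * c) + (2 * c ^+ 2 - 1))
    + (c + 1) * (5 - Num.sqrt 5 ^+ 2)); first by ring.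
  by rewrite h q5; ring.
move/eqP; rewrite !mulf_eq0 => /or3P[] /eqP h'; lra.
Qed.

Lemma lambda6 : lambda 6 = Num.sqrt 3 :> R.
Proof.
have := @lambda_gt0 6 isT; have : cos (3 * (pi / 6)) = 0 :> R.
  by rewrite -[RHS]cos_pihalf; congr cos; field.
rewrite cos_mul3 /lambda; set c := cos _ => h c0.
have c_neq0 : c != 0 by apply/eqP => c_eq0; move: c0; rewrite c_eq0 mulr0 ltxx.
have e : 3 = (2 * c) ^+ 2.
  apply: (mulIf c_neq0).
  by transitivity ((4 * c ^+ 3 - 3 * c) + 3 * c); [rewrite h; ring | ring].
by rewrite [in RHS]e sqrtr_sqr gtr0_norm.
Qed.

End Trigonometry.

(** * The nontrivial automorphism of Q(sqrt D) *)

Section Conjugation.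
Context {R : realType}.
Variables (D p : nat).
Hypothesis oddp : odd (logn p D).

(** A rational root would give num^2 = D den^2, where the valuation at [p] is even on the left and
    odd on the right. *)
Lemma sqrt_irrational (x : rat) : ratr x <> Num.sqrt D%:R :> R.
Proof.
move=> /(congr1 (fun y => y ^+ 2)); rewrite sqr_sqrtr ?ler0n // -rmorphXn /=.
rewrite -(ratr_nat R D) => /fmorph_inj xD.
have D0 : (0 < D)%N by case: (D) oddp => //; rewrite logn0.
have xnd : (numq x)%:~R ^+ 2 = D%:R * (denq x)%:~R ^+ 2 :> rat.
  by rewrite -xD -{2}(divq_num_den x) expr_div_n divfK // expf_neq0 ?intr_eq0.
have nd : (`|numq x| ^ 2 = D * `|denq x| ^ 2)%N.
  apply/eqP; rewrite -(eqr_nat rat) natrM !natrX !natr_absz !intr_norm.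
  by rewrite !real_normK ?num_real // xnd.
have d0 : (0 < `|denq x|)%N by rewrite absz_gt0.
move/(congr1 (logn p)): nd; rewrite lognM ?expn_gt0 ?d0 // !lognX => e.
move: oddp; rewrite -(addKn (2 * logn p `|denq x|) (logn p D)).
by rewrite addnC -e -mulnBr oddM.
Qed.

(** Coordinates over Q are unique, so the pair chosen by [xget] is the given one: otherwise sqrt D
    would equal (x' - x) / (y - y'). *)
Lemma conjQ_ratr (x y : rat) :
  conjQ D (ratr x + ratr y * Num.sqrt D%:R) =
  ratr x - ratr y * Num.sqrt D%:R :> R.
Proof.
rewrite /conjQ; set S := [set _ | _].
have : S (xget (0, 0) S) by apply: (@xgetPex _ (0, 0)); exists (x, y).
case: (xget _ _) => x' y' /=; rewrite /S /= => e.
suff yy' : y = y'.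
  by move: e; rewrite yy' => /addIr ->.
apply/eqP; apply: contraT => yy'.
case: (@sqrt_irrational ((x' - x) / (y - y'))).
rewrite fmorph_div !rmorphB /=; apply: (canLR (mulfK _)).
  by rewrite subr_eq0 (inj_eq (fmorph_inj _)).
rewrite mulrC mulrBl; apply/eqP; rewrite subr_eq addrAC -subr_eq opprK addrC.
by rewrite e addrC.
Qed.

(** For w = a + b sqrt D, the condition s = 2 a makes [s - w] equal to a - b sqrt D. This covers
    both sqrt D and the golden ratio. *)
Lemma conjQ_qev s (a b : rat) (x : qint) : zr s = 2 * ratr a :> R ->
  conjQ D (qev (ratr a + ratr b * Num.sqrt D%:R) x) =
  qev (zr s - (ratr a + ratr b * Num.sqrt D%:R)) x :> R.
Proof.
move=> ->; case: x => p1 p2; rewrite /qev /=.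
have zrq z : zr z = ratr ((int_of_Z z)%:~R) :> R by rewrite ratr_int.
rewrite !zrq; set x1 := _%:~R; set x2 := _%:~R.
transitivity (conjQ D (ratr (x1 + x2 * a) + ratr (x2 * b) * Num.sqrt D%:R) : R).
  by congr conjQ; rewrite !(rmorphD, rmorphM) /=; ring.
by rewrite conjQ_ratr !(rmorphD, rmorphM) /=; ring.
Qed.

End Conjugation.

(** * Exact versions of the branch matrices *)

Section Instances.
Context {R : realType}.

Definition zint (x : Z) : qint := (x, Z0).
Definition zmx (a b c d : qint) : qmat := ((a, b), (c, d)).
Definition q0 := zint Z0.
Definition q1 := zint (Zpos xH).
Definition qN1 := zint (Zneg xH).

Definition zalgI (s n : Z) (l m : nat) (lam_l lam_m : qint) (a : nat) : qmat :=
  let F := zmx q0 q1 q1 q0 in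
  let Q := zmx lam_l q1 qN1 q0 in
  let Rm := zmx q0 q1 qN1 lam_m in
  let i := ((a - 1) %/ (l - 1) + 1)%N in
  let j := ((a - 1) %% (l - 1) + 1)%N in
  let W := mmul s n (mexp s n Rm i) (mexp s n Q j) in
  if odd a then mmul s n W F else W.

Definition zalgII (s n : Z) (beta : qint) (a : nat) : qmat :=
  let J := zmx qN1 q0 q0 q1 in
  let P := zmx qN1 q1 q0 q1 in
  let M := zmx q1 q0 beta qN1 in
  let W := mexp s n (mmul s n M P) a./2 in
  if odd a then mmul s n (mmul s n W M) J else mmul s n W J.

Definition zalgIII (s n : Z) (alpha beta gamma delta : qint) (a : nat) : qmat :=
  let P x := zmx qN1 x q0 q1 in
  let M x := zmx q1 q0 x qN1 in
  let U k :=
    match k with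
    | 1%N => P gamma
    | 2%N => mmul s n (P gamma) (M delta)
    | _ => mmul s n (mmul s n (P gamma) (M delta)) (P gamma)
    end in
  let V j :=
    let W := mexp s n (mmul s n (M beta) (P alpha)) j./2 in
    if odd j then mmul s n W (M beta) else W in
  let j := ((a - 1) %/ 3 + 1)%N in
  let k := ((a - 1) %% 3)%N in
  mmul s n (V j) (if odd j then U (3 - k)%N else U (k + 1)%N).

Variables (s n : Z) (w : R).
Hypothesis w_root : w * w = zr s * w + zr n.

Lemma qev0 : qev w q0 = 0. Proof. by rewrite /qev zr0 mul0r addr0. Qed.
Lemma qev1 : qev w q1 = 1. Proof. by rewrite /qev zr0 zr1 mul0r addr0. Qed.
Lemma qevN1 : qev w qN1 = -1. Proof. by rewrite /qev zr0 mul0r addr0. Qed.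

Lemma mev_zmx a b c d :
  mev w (zmx a b c d) = mx22 (qev w a) (qev w b) (qev w c) (qev w d).
Proof. by []. Qed.

Definition mev_ring := (mevM w_root, mevX w_root).
Definition mev_entries := (mev_zmx, qev0, qev1, qevN1).

Lemma mev_mnormal A (B : 'M[R]_2) : B = mev w A ->
  B = mev w (mnormal s n A) \/ B = - mev w (mnormal s n A).
Proof.
by move=> ->; rewrite /mnormal; case: ifP; [left|right]; rewrite ?mevN ?opprK.
Qed.

Lemma branch_algI l m D ql qm a :
  lambda l = qev w ql -> lambda m = qev w qm ->
  branch (@algI R l m D) a = mev w (zalgI s n l m ql qm a).
Proof.
move=> hl hm; rewrite /zalgI /= hl hm.
by case: ifP; rewrite !mev_ring !mev_entries.
Qed.

Lemma branch_algII l D beta qb a : beta = qev w qb ->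
  branch (@algII R l D beta) a = mev w (zalgII s n qb a).
Proof.
by move=> ->; rewrite /zalgII /=; case: ifP; rewrite !mev_ring !mev_entries.
Qed.

Lemma branch_algIII m D alpha beta gamma delta qa qb qg qd a :
  alpha = qev w qa -> beta = qev w qb -> gamma = qev w qg -> delta = qev w qd ->
  branch (@algIII R m D alpha beta gamma delta) a =
  mev w (zalgIII s n qa qb qg qd a).
Proof.
move=> -> -> -> ->; rewrite /zalgIII /= (mevM w_root); congr (_ * _).
  by case: ifP; rewrite !mev_ring !mev_entries.
have U k : match k with
    | 1%N => mx22 (-1) (qev w qg) 0 1
    | 2%N => mx22 (-1) (qev w qg) 0 1 * mx22 1 0 (qev w qd) (-1)
    | _ => mx22 (-1) (qev w qg) 0 1 * mx22 1 0 (qev w qd) (-1) *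
           mx22 (-1) (qev w qg) 0 1
    end = mev w match k with
    | 1%N => zmx qN1 qg q0 q1
    | 2%N => mmul s n (zmx qN1 qg q0 q1) (zmx q1 q0 qd qN1)
    | _ => mmul s n (mmul s n (zmx qN1 qg q0 q1) (zmx q1 q0 qd qN1))
             (zmx qN1 qg q0 q1)
    end.
  by case: k => [|[|[|k]]]; rewrite ?mev_ring !mev_entries.
by case: ifP => _; exact: U.
Qed.

End Instances.

(** * Reduction to a computation for w = sqrt D and for w = golden ratio *)

Section Quadratic.
Context {R : realType}.

Lemma zr_nat k : zr (Z.of_nat k) = k%:R :> R.
Proof. by rewrite /zr pmulrn; congr (_%:~R); lia. Qed.

(* [flip] tells whether det A_1 = -1; 5 bounds the depth of the search. *)
Definition search_succeeds (s n : Z) (lt : nat -> qmat) (r : nat)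
    (flip : bool) : bool :=
  [&& (0 < r)%N,
      mdet s n (mnormal s n (lt 1%N)) == (if flip then qN1 else q1) &
      check s n (fun c => mnormal s n (lt c)) r
        (if flip then [:: r] else [:: r; 1%N]) 5].

Lemma complete_of_search (s n : Z) (w : R) D (T : algorithm R) lt flip :
  w * w = zr s * w + zr n -> zr s < 2 * w ->
  (forall x, conjQ D (qev w x) = qev (zr s - w) x) ->
  radicand T = D -> (forall a, branch T a = mev w (lt a)) ->
  search_succeeds s n lt (nletters T) flip ->
  admits_complete_set_of_decreasing_blocks T.
Proof.
move=> root gt conj rad br /and3P[r0 /eqP det1 chk].
apply: (complete_of_check root gt conj (lt := fun c => mnormal s n (lt c))
  (flip := flip) (fuel := 5)) => //.
  by move=> c _; exact: mev_mnormal.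
by rewrite det1; case: (flip).
Qed.

Lemma complete_sqrt (D p : nat) (T : algorithm R) lt flip :
  odd (logn p D) -> radicand T = D ->
  (forall a, branch T a = mev (Num.sqrt D%:R) (lt a)) ->
  search_succeeds Z0 (Z.of_nat D) lt (nletters T) flip ->
  admits_complete_set_of_decreasing_blocks T.
Proof.
move=> odd_p rad br; apply: complete_of_search rad br.
- by rewrite -expr2 sqr_sqrtr // zr0 mul0r add0r zr_nat.
- rewrite zr0 mulr_gt0 // sqrtr_gt0 ltr0n.
  by case: (D) odd_p => //; rewrite logn0.
move=> x; have := @conjQ_qev R D p odd_p Z0 0 1 x.
by rewrite zr0 rmorph0 rmorph1 mulr0 add0r mul1r; apply.
Qed.

Lemma golden_root : golden * golden = golden + 1 :> R.
Proof.
have q5 : Num.sqrt 5 ^+ 2 = 5 :> R by rewrite sqr_sqrtr.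
rewrite /golden; transitivity ((1 + 2 * Num.sqrt 5 + Num.sqrt 5 ^+ 2) / 4 : R).
  by field.
by rewrite q5; field.
Qed.

Lemma complete_golden (T : algorithm R) lt flip : radicand T = 5%N ->
  (forall a, branch T a = mev golden (lt a)) ->
  search_succeeds (Zpos xH) (Zpos xH) lt (nletters T) flip ->
  admits_complete_set_of_decreasing_blocks T.
Proof.
move=> rad br; apply: complete_of_search rad br.
- by rewrite zr1 mul1r golden_root.
- by rewrite zr1 /golden mulrC divfK // ltrDl sqrtr_gt0.
have half : ratr (2%:R^-1)%R = 2^-1 :> R by rewrite fmorphV rmorph_nat.
have -> : golden = ratr (2%:R^-1)%R + ratr (2%:R^-1)%R * Num.sqrt 5%:R :> R.
  by rewrite half /golden mulrDl mul1r mulrC.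
by move=> x; apply: (@conjQ_qev R 5 5) => //; rewrite zr1 half mulfV.
Qed.

End Quadratic.

(** * The nine algorithms *)

Definition q_w : qint := (Z0, Zpos xH).

Theorem theorem5p3 (R : realType) :
  [/\ [/\ admits_complete_set_of_decreasing_blocks (@algI R 2 5 5),
          admits_complete_set_of_decreasing_blocks (@algI R 3 4 2),
          admits_complete_set_of_decreasing_blocks (@algI R 3 5 5) &
          admits_complete_set_of_decreasing_blocks (@algI R 3 6 3)],
      [/\ admits_complete_set_of_decreasing_blocks
            (@algII R 4 2 (2 + Num.sqrt 2)),
          admits_complete_set_of_decreasing_blocks
            (@algII R 5 5 (2 + golden)) &
          admits_complete_set_of_decreasing_blocks
            (@algII R 6 3 (2 + Num.sqrt 3))],
      admits_complete_set_of_decreasing_blocks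
        (@algIII R 6 6 (3 - Num.sqrt 6) (3 + Num.sqrt 6)
                       (2 - Num.sqrt 6) (-2 - Num.sqrt 6)) &
      admits_complete_set_of_decreasing_blocks
        (@algIII R 12 3 1 (2 + Num.sqrt 3)
                        (1 - Num.sqrt 3) (-1 - Num.sqrt 3))].
Proof.
have qE (w : R) (a b : Z) : qev w (a, b) = zr a + zr b * w by [].
have w_qw (w : R) : w = qev w q_w by rewrite qE zr0 zr1 add0r mul1r.
have w_root D : Num.sqrt D%:R * Num.sqrt D%:R =
    zr Z0 * Num.sqrt D%:R + zr (Z.of_nat D) :> R.
  by rewrite -expr2 sqr_sqrtr // zr0 mul0r add0r zr_nat.
have g_root : golden * golden = zr (Zpos xH) * golden + zr (Zpos xH) :> R.
  by rewrite zr1 mul1r golden_root.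
have zrm1 : zr (Zneg xH) = -1 :> R by [].
split; [split | split | | ].
(* In every case [//] evaluates the search. The flag is [true] for type I, where A_1 carries the
   factor F of determinant -1, and [false] for types II and III, where A_1 is a product of two or
   four matrices of determinant -1. *)
- apply: (@complete_golden _ _ (zalgI (Zpos xH) (Zpos xH) 2 5 q0 q_w) true)
    => // a.
  by apply: (branch_algI g_root); rewrite ?lambda2 ?qev0 ?lambda5.
(* The second number is a prime with odd exponent in the radicand. *)
- apply: (@complete_sqrt _ 2 2 _ (zalgI Z0 (Zpos 2) 3 4 q1 q_w) true) => // a.
  by apply: (branch_algI (w_root 2%N)); rewrite ?lambda3 ?qev1 ?lambda4.
- apply: (@complete_golden _ _ (zalgI (Zpos xH) (Zpos xH) 3 5 q1 q_w) true)
    => // a.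
  by apply: (branch_algI g_root); rewrite ?lambda3 ?qev1 ?lambda5.
- apply: (@complete_sqrt _ 3 3 _ (zalgI Z0 (Zpos 3) 3 6 q1 q_w) true) => // a.
  by apply: (branch_algI (w_root 3%N)); rewrite ?lambda3 ?qev1 ?lambda6.
- apply: (@complete_sqrt _ 2 2 _ (zalgII Z0 (Zpos 2) (Zpos 2, Zpos 1)) false)
    => // a.
  by apply: (branch_algII (w_root 2%N)); rewrite qE zr1 mul1r.
- apply: (@complete_golden _ _
    (zalgII (Zpos xH) (Zpos xH) (Zpos 2, Zpos 1)) false) => // a.
  by apply: (branch_algII g_root); rewrite qE zr1 mul1r.
- apply: (@complete_sqrt _ 3 3 _ (zalgII Z0 (Zpos 3) (Zpos 2, Zpos 1)) false)
    => // a.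
  by apply: (branch_algII (w_root 3%N)); rewrite qE zr1 mul1r.
- apply: (@complete_sqrt _ 6 3 _ (zalgIII Z0 (Zpos 6) (Zpos 3, Zneg 1)
    (Zpos 3, Zpos 1) (Zpos 2, Zneg 1) (Zneg 2, Zneg 1)) false) => // a.
  by apply: (branch_algIII (w_root 6%N)); rewrite qE ?zr1 ?zrm1 ?mul1r ?mulN1r.
- apply: (@complete_sqrt _ 3 3 _ (zalgIII Z0 (Zpos 3) (Zpos 1, Z0)
    (Zpos 2, Zpos 1) (Zpos 1, Zneg 1) (Zneg 1, Zneg 1)) false) => // a.
  by apply: (branch_algIII (w_root 3%N));
    rewrite qE ?zr0 ?zr1 ?zrm1 ?mul1r ?mulN1r ?mul0r ?addr0.
Qed.
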